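(* Let $(V,\omega)$ be a symplectic vector space of dimension $2n$. The decomposition of $\wedge^\bullet V^*\otimes\mathbb{C}$ induced by the generalized complex structure determined by $\omega$ is given by $$U^{n-k}=\{e^{i\omega}(e^{\frac{\Lambda}{2i}}\alpha)\ :\ \alpha\in\wedge^kV^*\otimes\mathbb{C}\}.$$ Hence the natural isomorphism $$\varphi:\wedge^\bullet V^*\otimes\mathbb{C}\to\wedge^\bullet V^*\otimes\mathbb{C},\qquad \varphi(\alpha)=e^{i\omega}e^{\frac{\Lambda}{2i}}\alpha,$$ is such that $\varphi:\wedge^kV^*\otimes\mathbb{C}\cong U^{n-k}$.
   Context: $(V\oplus V^* )\otimes\mathbb{C}$ acts on $\wedge^\bullet V^*\otimes\mathbb{C}$ by $(X+\xi)\cdot\rho=X\lfloor\rho+\xi\wedge\rho$. The generalized complex structure determined by $\omega$ has $+i$-eigenspace $L=\{X-iX\lfloor\omega: X\in V\otimes\mathbb{C}\}$, which is the annihilator of $e^{i\omega}$. The associated decomposition of forms is $\wedge^\bullet V^*\otimes\mathbb{C}=\bigoplus_{k=-n}^nU^k$, where $U^n=\mathrm{span}\{e^{i\omega}\}$ and $U^{n-k}=\wedge^k\overline{L}\cdot e^{i\omega}=\overline{L}\cdot U^{n-k+1}$, with $\overline{L}=\{X+iX\lfloor\omega: X\in V\otimes\mathbb{C}\}$. $\Lambda:\wedge^kV^*\to\wedge^{k-2}V^*$ is the operator of interior product with the bivector $\omega^{-1}$, with sign normalized so that, in Darboux coordinates with $\omega=\sum_idx_i\wedge dy_i$, one has $\Lambda=\sum_i\iota_{\partial_{x_i}}\iota_{\partial_{y_i}}$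 (so $\Lambda(dx_i\wedge dy_i)=-1$, and with $L_\omega=\omega\wedge$ one has $[L_\omega,\Lambda]=n-k$ on $k$-forms). Exponentials are $e^{\frac{\Lambda}{2i}}=\sum_j\frac{1}{j!}\left(\frac{\Lambda}{2i}\right)^j$ and $e^{i\omega}$ acts by wedge product. *)

(* Defs.v *)
From HB Require Import structures.
From mathcomp Require Import all_boot all_order all_algebra.
From mathcomp Require Import complex.
From mathcomp Require Import boolp classical_sets functions reals.

Set Implicit Arguments.
Unset Strict Implicit.
Unset Printing Implicit Defensive.

Import Order.TTheory GRing.Theory Num.Theory.
Local Open Scope ring_scope.
Local Open Scope classical_set_scope.

Section Forms.
Variables (R : realType) (V : vectType R).

(* A complex form of mixed degree is encoded by its values on all finite lists
   of vectors, its degree-k component being the restriction to lists of length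
   k. Operators are defined on the ambient C-module of all functions on lists;
   the predicates below carve out the forms. *)
Definition form := seq V -> R[i]^o.

Definition multilinear (rho : form) :=
  forall (s1 s2 : seq V) (a : R) (u v : V),
    rho (s1 ++ (a *: u + v) :: s2)
    = (a%:C)%C * rho (s1 ++ u :: s2) + rho (s1 ++ v :: s2).

Definition alternating (rho : form) :=
  forall (s1 s2 s3 : seq V) (v : V), rho (s1 ++ v :: s2 ++ v :: s3) = 0.

(* This is the direct sum of the spaces [forms_deg k]: alternating forms of
   degree larger than the dimension of V vanish. *)
Definition forms : set form := [set rho | multilinear rho /\ alternating rho].

Definition forms_deg (k : nat) : set form :=
  [set rho | forms rho /\ forall s, size s != k -> rho s = 0].

Definition form_one : form := fun s => (s == [::])%:R.

(* The bits of [m] select the arguments of the left factor, so that m ranges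
   over all shuffles and (-1) ^ [inversions m] is the sign of the shuffle. With this
   normalization (a /\ b)(u, v) = a u * b v - a v * b u for 1-forms a, b. *)
Definition inversions (m : seq bool) : nat :=
  (\sum_(i < size m) \sum_(j < i) (nth false m i && ~~ nth false m j))%N.

Definition wedge (a b : form) : form := fun s =>
  \sum_(m : (size s).-tuple bool)
    (-1) ^+ inversions m * a (mask m s) * b (mask (map negb m) s).

(* (x, y) stands for x + i y in the complexification of V. *)
Definition cvect := (V * V)%type.

Definition contract (X : cvect) (rho : form) : form :=
  fun s => rho (X.1 :: s) + 'i * rho (X.2 :: s).

(* The action of (X, xi), for a complex vector X and a complex 1-form xi. *)
Definition clifford (x : cvect * form) (rho : form) : form :=
  contract x.1 rho + wedge x.2 rho.

Definition cspan (S : set form) : set form :=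
  [set rho | exists (m : nat) (c : 'I_m -> R[i]) (f : 'I_m -> form),
     (forall i, S (f i)) /\ rho = \sum_(i < m) c i *: f i].

(* The exponential series is truncated at the dimension of V: it is only used
   for operators that change the degree of forms by 2 or by -2, whose later
   powers vanish on forms. *)
Definition exp_op (A : form -> form) (rho : form) : form :=
  \sum_(j < (\dim {:V}).+1) (j`!%:R)^-1 *: iter j A rho.

Variable omega : {skew_symmetric V}.

Definition form_of : form := fun s =>
  if s is [:: u; v] then (omega u v)%:C%C else 0.

Definition exp_iomega : form := exp_op (wedge ('i *: form_of)) form_one.

Definition Lbar : set (cvect * form) :=
  [set (X, 'i *: contract X form_of) | X in [set: cvect]].

(* [Uspace k] is the space U^(n-k). *)
Fixpoint Uspace (k : nat) : set form :=
  if k is k'.+1 then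
    cspan [set clifford x rho | x in Lbar & rho in Uspace k']
  else cspan [set exp_iomega].

(* In a basis b of V with Gram matrix W_ij = omega(b_i, b_j), the bivector is
   1/2 sum_ij pi_ij b_i /\ b_j where pi is the transpose of W^-1; this does not
   depend on b. In a Darboux basis (d/dx_i, d/dy_i), with omega(d/dx_i, d/dy_i)
   equal to 1, it is the sum of the (d/dx_i) /\ (d/dy_i), and Lambda is the sum
   of the iota_(d/dx_i) iota_(d/dy_i). *)
Definition gram : 'M[R]_(\dim {:V}) :=
  \matrix_(i, j) omega (vbasis {:V})`_i (vbasis {:V})`_j.

Definition Lambda (rho : form) : form :=
  2^-1 *: \sum_(i < \dim {:V}) \sum_(j < \dim {:V})
    ((invmx gram)^T i j)%:C%C *:
      contract ((vbasis {:V})`_i, 0) (contract ((vbasis {:V})`_j, 0) rho).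

Definition exp_Lambda_2i : form -> form :=
  exp_op (fun rho => (2 * 'i)^-1 *: Lambda rho).

Definition phi (alpha : form) : form := wedge exp_iomega (exp_Lambda_2i alpha).

End Forms.

Arguments forms {R V}.
Arguments forms_deg {R V} k.

(* Main.v *)
From HB Require Import structures.
From Pilot Require Import Defs.
From mathcomp Require Import all_boot all_order all_algebra.
From mathcomp Require Import complex.
From mathcomp Require Import boolp classical_sets functions reals.

(** Write xi_X for iota_X omega, and phi = e^(i omega) e^(Lambda / 2i). The
    theorem holds because phi intertwines two families of operators that build
    both sides from their lowest piece:

      phi (2i xi_X /\ alpha) = (X + i xi_X) . phi alpha.

    Indeed [Lambda, xi_X /\] = iota_X ([Lambda_wedge_xi]) and
    [iota_X, omega /\] = xi_X /\ ([contract_wedge_omega]). Since each of these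
    commutators commutes with the operator that is exponentiated, conjugation
    by e^(Lambda / 2i) turns 2i xi_X /\ into 2i xi_X /\ + iota_X, and conjugation
    by e^(i omega) turns iota_X into iota_X - i xi_X /\ and fixes xi_X /\
    ([exp_op_conj], [phi_clifford]).

    The spaces U^(n-k) arise from U^n, spanned by e^(i omega) = phi 1, by acting
    with the elements X + i xi_X. The forms of degree k arise in the same way
    from the constants by the products xi_X /\: because omega is nondegenerate,
    the xi_X are all the 1-forms, and the Euler identity
    sum_i b^i /\ iota_(b_i) alpha = k alpha writes a form of degree k through
    forms of degree k - 1 ([sum_wedge_interior]). Induction on k gives
    U^(n-k) = phi (forms of degree k) ([Uspace_phi]).

    Finally phi is bijective because omega /\ and Lambda are nilpotent on forms,
    so that their truncated exponentials are inverted by those of the opposite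
    operators ([exp_opK], [phi_bij]).

    The exterior algebra is developed from one recursion, which removes the
    first argument of a product ([interior_wedge]). It holds for arbitrary
    functions on lists, and gives associativity and graded commutativity by
    induction on the list of arguments. *)

Set Implicit Arguments.
Unset Strict Implicit.
Unset Printing Implicit Defensive.

Import Order.TTheory GRing.Theory Num.Theory.
Local Open Scope ring_scope.
Local Open Scope classical_set_scope.

(* Sesquilinear forms on row vectors carry the same short name. *)
Local Notation form := Pilot.Defs.form.

(** * Exterior product and interior product on functions of lists *)

Section ShuffleProduct.
Variables (R : realType) (V : vectType R).
Implicit Types (a b c rho : form V) (u v : V) (s : seq V) (z : R[i]).

Lemma formDE a b s : (a + b) s = a s + b s. Proof. by []. Qed.

Lemma formNE a s : (- a) s = - a s. Proof. by []. Qed.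

Lemma formZE z a s : (z *: a) s = z * a s. Proof. by []. Qed.

Lemma form_sumE (I : Type) (r : seq I) (F : I -> form V) s :
  (\sum_(i <- r) F i) s = \sum_(i <- r) F i s.
Proof. exact: (big_morph (fun a : form V => a s)). Qed.

Definition interior v rho : form V := fun s => rho (v :: s).

Arguments interior : simpl never.

Fact interior_is_linear v : linear (interior v). Proof. by []. Qed.

HB.instance Definition _ v :=
  GRing.isLinear.Build R[i] (form V) (form V) _ (interior v) (interior_is_linear v).

Lemma interiorD v a b : interior v (a + b) = interior v a + interior v b.
Proof. by []. Qed.

Lemma interiorN v a : interior v (- a) = - interior v a.
Proof. by []. Qed.

Lemma interiorZ v z a : interior v (z *: a) = z *: interior v a.
Proof. by []. Qed.

Lemma contractE (X : cvect V) rho :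
  contract X rho = interior X.1 rho + 'i *: interior X.2 rho.
Proof. by []. Qed.

Fact contract_is_linear (X : cvect V) : linear (contract X).
Proof.
move=> z a b; rewrite !contractE !interiorD !interiorZ !scalerDr !scalerA.
by rewrite [_ * z]mulrC addrACA.
Qed.

HB.instance Definition _ (X : cvect V) :=
  GRing.isLinear.Build R[i] (form V) (form V) _ (contract X)
    (contract_is_linear X).

Lemma contractZ (X : cvect V) z a : contract X (z *: a) = z *: contract X a.
Proof. exact: linearZZ. Qed.

Fact wedge_is_linear a : linear (wedge a).
Proof.
move=> z b c; apply/funext => s; rewrite formDE formZE /wedge mulr_sumr.
rewrite -big_split /=; apply: eq_bigr => m _.
by rewrite formDE formZE mulrDr mulrCA.
Qed.

HB.instance Definition _ a :=
  GRing.isLinear.Build R[i] (form V) (form V) _ (wedge a) (wedge_is_linear a).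

Lemma wedgeDr a b c : wedge a (b + c) = wedge a b + wedge a c.
Proof. exact: linearD. Qed.

Lemma wedgeNr a b : wedge a (- b) = - wedge a b.
Proof. exact: linearN. Qed.

Lemma wedgeZr z a b : wedge a (z *: b) = z *: wedge a b.
Proof. exact: linearZZ. Qed.

Lemma wedge0r a : wedge a 0 = 0.
Proof. exact: linear0. Qed.

Lemma wedge_linearl c : linear (fun a => wedge a c).
Proof.
move=> z a b; apply/funext => s; rewrite formDE formZE /wedge mulr_sumr.
rewrite -big_split /=; apply: eq_bigr => m _.
by rewrite formDE formZE mulrDr mulrDl -!mulrA mulrCA.
Qed.

Lemma wedgeDl a b c : wedge (a + b) c = wedge a c + wedge b c.
Proof. by have := wedge_linearl c 1 a b; rewrite !scale1r. Qed.

Lemma wedge0l b : wedge 0 b = 0.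
Proof. by apply: (addrI (wedge 0 b)); rewrite -wedgeDl !addr0. Qed.

Lemma wedgeZl z a b : wedge (z *: a) b = z *: wedge a b.
Proof. by have := wedge_linearl b z a 0; rewrite !addr0 wedge0l addr0. Qed.

Lemma wedgeNl a b : wedge (- a) b = - wedge a b.
Proof. by rewrite -scaleN1r wedgeZl scaleN1r. Qed.

Lemma wedge_suml (I : Type) (r : seq I) (F : I -> form V) b :
  wedge (\sum_(i <- r) F i) b = \sum_(i <- r) wedge (F i) b.
Proof.
by rewrite (big_morph (fun a => wedge a b) (fun x y => wedgeDl x y b) (wedge0l b)).
Qed.

(** The grading involution: it measures the sign of moving a vector past a form. *)
Definition gsign a : form V := fun s => (-1) ^+ size s * a s.

Arguments gsign : simpl never.

Fact gsign_is_linear : linear gsign.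
Proof.
move=> z a b; apply/funext => s.
by rewrite /gsign !(formDE, formZE) mulrDr mulrCA.
Qed.

HB.instance Definition _ :=
  GRing.isLinear.Build R[i] (form V) (form V) _ gsign gsign_is_linear.

Lemma gsignK : involutive gsign.
Proof.
move=> a; apply/funext => s; rewrite /gsign mulrA -exprD -signr_odd addnn.
by rewrite odd_double mul1r.
Qed.

Lemma interior_gsign v a : interior v (gsign a) = - gsign (interior v a).
Proof.
by apply/funext => s; rewrite formNE /interior /gsign /= exprS mulN1r mulNr.
Qed.

Lemma big_tuple_cons n (F : n.+1.-tuple bool -> R[i]) :
  \sum_(m : n.+1.-tuple bool) F m =
  \sum_(m : n.-tuple bool) F [tuple of true :: m] +
  \sum_(m : n.-tuple bool) F [tuple of false :: m].
Proof.
rewrite (reindex (fun p : bool * n.-tuple bool => [tuple of p.1 :: p.2])) /=.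
  rewrite -(pair_bigA _ (fun x (m : n.-tuple bool) => F [tuple of x :: m])) /=.
  by rewrite big_bool.
exists (fun m => (thead m, [tuple of behead m])) => [[x m] _|m _] /=.
  by congr pair; apply: val_inj.
by rewrite [m in RHS]tuple_eta; apply: val_inj.
Qed.

Lemma inversions_cons (x : bool) (m : seq bool) :
  inversions (x :: m) = (~~ x * count id m + inversions m)%N.
Proof.
have -> : count id m = (\sum_(i < size m) nth false m i)%N.
  rewrite -sum1_count big_mkcond (big_nth false) big_mkord.
  by apply: eq_bigr => i _; case: nth.
rewrite /inversions /= big_ord_recl big_ord0 add0n big_distrr -big_split /=.
apply: eq_bigr => i _; rewrite big_ord_recl /=; congr addn.
by case: nth; case: x.
Qed.

Lemma wedge_nil a b : wedge a b [::] = a [::] * b [::].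
Proof.
rewrite /wedge (bigD1 [tuple]) //= big1 ?addr0 => [|m]; last first.
  by case/eqP; rewrite tuple0.
by rewrite /inversions big_ord0 mul1r.
Qed.

(** Splitting the shuffles according to the factor that receives the first
    argument. Together with [wedge_nil] this is a recursive description of the
    product, from which its algebra follows by induction on the list. *)
Lemma interior_wedge v a b :
  interior v (wedge a b) = wedge (interior v a) b + wedge (gsign a) (interior v b).
Proof.
apply/funext => s; rewrite formDE /interior /wedge /= big_tuple_cons.
congr (_ + _); apply: eq_bigr => m _ /=.
  by rewrite inversions_cons mul0n.
rewrite inversions_cons mul1n exprD /gsign size_mask ?size_tuple //.
by rewrite -!mulrA mulrCA.
Qed.

Lemma wedge_cons a b v s : wedge a b (v :: s) =
  wedge (interior v a) b s + wedge (gsign a) (interior v b) s.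
Proof. by rewrite -[LHS]/(interior v (wedge a b) s) interior_wedge. Qed.

Lemma wedge_eq0 a b s :
  (forall s1 s2, (size s1 + size s2)%N = size s -> a s1 * b s2 = 0) ->
  wedge a b s = 0.
Proof.
move=> ab0; rewrite /wedge big1 // => m _; rewrite -mulrA ab0 ?mulr0 //.
rewrite !size_mask ?size_map ?size_tuple // count_map.
by rewrite (count_predC id m) size_tuple.
Qed.

Lemma gsign_wedge a b : gsign (wedge a b) = wedge (gsign a) (gsign b).
Proof.
apply/funext => s; elim: s a b => [|v s IHs] a b.
  by rewrite /gsign /= !wedge_nil !expr0 !mul1r.
rewrite wedge_cons !interior_gsign -[LHS]/(interior v (gsign (wedge a b)) s).
rewrite interior_gsign interior_wedge formNE linearD /= formDE !IHs opprD.
by rewrite wedgeNl wedgeNr !formNE.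
Qed.

Lemma wedgeA a b c : wedge a (wedge b c) = wedge (wedge a b) c.
Proof.
apply/funext => s; elim: s a b c => [|v s IHs] a b c.
  by rewrite !wedge_nil mulrA.
rewrite !wedge_cons !interior_wedge wedgeDr wedgeDl !formDE !IHs gsign_wedge.
by rewrite addrA.
Qed.

Lemma interior_one v : interior v (@form_one R V) = 0. Proof. by []. Qed.

Lemma gsign_one : gsign (@form_one R V) = @form_one R V.
Proof.
apply/funext => -[|v s]; rewrite /gsign /form_one /= ?expr0 ?mul1r //.
by rewrite mulr0.
Qed.

Lemma wedge1l a : wedge (@form_one R V) a = a.
Proof.
apply/funext => s; elim: s a => [|v s IHs] a.
  by rewrite wedge_nil /form_one eqxx mul1r.
by rewrite wedge_cons interior_one wedge0l gsign_one IHs add0r.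
Qed.

(** Graded commutativity. The two parities of the first factor are treated
    together because an interior product exchanges them. *)
Lemma wedge_parity s a b :
  (gsign a = a -> wedge a b s = wedge b a s) /\
  (gsign a = - a -> wedge a b s = wedge (gsign b) a s).
Proof.
elim: s a b => [|v s IHs] a b.
  by rewrite !wedge_nil /gsign /= expr0 mul1r mulrC.
have interior_even : gsign a = a -> gsign (interior v a) = - interior v a.
  by move=> ev; rewrite -[in RHS]ev interior_gsign opprK.
have interior_odd : gsign a = - a -> gsign (interior v a) = interior v a.
  by move=> od; rewrite -[LHS]opprK -interior_gsign od linearN opprK.
split=> pa; rewrite !wedge_cons pa addrC.
  rewrite (proj1 (IHs a (interior v b)) pa).
  by rewrite (proj2 (IHs (interior v a) b) (interior_even pa)).
rewrite gsignK wedgeNl formNE (proj2 (IHs a (interior v b)) pa).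
rewrite (proj1 (IHs (interior v a) b) (interior_odd pa)) interior_gsign.
by rewrite wedgeNl formNE.
Qed.

Lemma wedge_evenC a b : gsign a = a -> wedge a b = wedge b a.
Proof. by move=> ev; apply/funext => s; apply: (proj1 (wedge_parity s a b) ev). Qed.

End ShuffleProduct.

(** * Alternating multilinear forms *)

Section ExteriorForms.
Variables (R : realType) (V : vectType R).
Implicit Types (a b c rho : form V) (u v : V) (s : seq V) (z : R[i]).

Lemma interior_lin rho (k : R) u v : multilinear rho ->
  interior (k *: u + v) rho = (k%:C)%C *: interior u rho + interior v rho.
Proof. by move=> mrho; apply/funext => s; apply: (mrho [::]). Qed.

Lemma interior0 rho : multilinear rho -> interior 0 rho = 0.
Proof.
move=> mrho; have := interior_lin 1 0 0 mrho.
by rewrite scaler0 addr0 scale1r -[in LHS](addr0 (interior _ _)) => /addrI.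
Qed.

Lemma interiorDv rho u v : multilinear rho ->
  interior (u + v) rho = interior u rho + interior v rho.
Proof. by move=> mrho; have := interior_lin 1 u v mrho; rewrite !scale1r. Qed.

Lemma interior_sumv rho (I : Type) (r : seq I) (k : I -> R) (v : I -> V) :
  multilinear rho ->
  interior (\sum_(i <- r) k i *: v i) rho =
  \sum_(i <- r) (k i)%:C%C *: interior (v i) rho.
Proof.
move=> mrho; elim: r => [|i r IHr]; first by rewrite !big_nil interior0.
by rewrite !big_cons interior_lin // IHr.
Qed.

Lemma multilinear_interior v rho : multilinear rho -> multilinear (interior v rho).
Proof. by move=> mrho s1 s2 k u w; apply: (mrho (v :: s1)). Qed.

(** For a multilinear function it is enough that adjacent equal arguments
    give zero: adjacent exchanges then change the sign, and bring any two
    equal arguments together. *)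
Lemma adjacent_alternating rho : multilinear rho ->
  (forall s1 s2 v, rho (s1 ++ v :: v :: s2) = 0) -> alternating rho.
Proof.
move=> mrho adj; have exch s1 s2 u v :
    rho (s1 ++ u :: v :: s2) = - rho (s1 ++ v :: u :: s2).
  apply/eqP; rewrite -addr_eq0; apply/eqP.
  have D x y t1 t2 : rho (t1 ++ (x + y) :: t2) =
      rho (t1 ++ x :: t2) + rho (t1 ++ y :: t2).
    by have := mrho t1 t2 1 x y; rewrite scale1r mul1r.
  have := adj s1 s2 (u + v); rewrite D -!(cat_rcons u s1) -!(cat_rcons v s1) !D.
  by rewrite !cat_rcons !adj add0r addr0.
move=> s1 s2 s3 v; elim: s2 s1 => [|w s2 IHs2] s1 /=; first exact: adj.
by rewrite exch -cat_rcons IHs2 oppr0.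
Qed.

Lemma alternating_interior v rho : alternating rho -> alternating (interior v rho).
Proof. by move=> arho s1 s2 s3 u; apply: (arho (v :: s1)). Qed.

Lemma forms_interior v rho : forms rho -> forms (interior v rho).
Proof.
case=> mrho arho; split; first exact: multilinear_interior.
exact: alternating_interior.
Qed.

Lemma interior_interior v rho : forms rho -> interior v (interior v rho) = 0.
Proof. by case=> _ arho; apply/funext => s; apply: (arho [::] [::]). Qed.

Lemma interiorC u v rho : forms rho ->
  interior u (interior v rho) = - interior v (interior u rho).
Proof.
move=> frho; apply/eqP; rewrite -addr_eq0; apply/eqP.
have := interior_interior (u + v) frho.
have mu w : multilinear (interior w rho) by case: (forms_interior w frho).
rewrite (interiorDv _ _ frho.1) interiorD !interiorDv // !interior_interior //.
by rewrite add0r addr0 addrC.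
Qed.

Lemma forms_lin z a b : forms a -> forms b -> forms (z *: a + b).
Proof.
move=> [ma aa] [mb ab]; split=> [s1 s2 k u v|s1 s2 s3 v].
  rewrite !(formDE, formZE) ma mb !mulrDr addrACA; congr (_ + _).
  by congr (_ + _); rewrite mulrCA.
by rewrite formDE formZE aa ab mulr0 addr0.
Qed.

Lemma forms0 : forms (0 : form V).
Proof.
by split=> [s1 s2 k u v|s1 s2 s3 v] //=; rewrite -[0 _]/(0 : R[i]) mulr0 addr0.
Qed.

Lemma formsD a b : forms a -> forms b -> forms (a + b).
Proof. by move=> fa fb; rewrite -[a]scale1r; apply: forms_lin. Qed.

Lemma formsZ z a : forms a -> forms (z *: a).
Proof.
by move=> fa; rewrite -[_ *: _]addr0; apply: forms_lin => //; apply: forms0.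
Qed.

Lemma forms_sum (I : Type) (r : seq I) (F : I -> form V) :
  (forall i, forms (F i)) -> forms (\sum_(i <- r) F i).
Proof.
by move=> fF; elim/big_rec: _ => [|i a _ fa]; [apply: forms0|apply: formsD].
Qed.

Lemma forms_contract (X : cvect V) rho : forms rho -> forms (contract X rho).
Proof.
by move=> frho; rewrite contractE; apply/formsD/formsZ; apply: forms_interior.
Qed.

Lemma interior_contract v (X : cvect V) rho : forms rho ->
  interior v (contract X rho) = - contract X (interior v rho).
Proof.
move=> frho; rewrite !contractE interiorD interiorZ.
rewrite [interior v (interior X.1 _)]interiorC //.
by rewrite [interior v (interior X.2 _)]interiorC // scalerN opprD.
Qed.

Lemma forms_gsign a : forms a -> forms (gsign a).
Proof.
move=> [ma aa]; split=> [s1 s2 k u v|s1 s2 s3 v]; last by rewrite /gsign aa mulr0.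
by rewrite /gsign ma !size_cat /= mulrDr mulrCA.
Qed.

Lemma forms_wedge a b : forms a -> forms b -> forms (wedge a b).
Proof.
move=> fa fb; have mab : multilinear (wedge a b).
  move=> s1 s2 k u v; elim: s1 a b fa fb => [|w s1 IHs1] a b fa fb /=.
    have [[ma _] [mb _]] := (fa, fb).
    rewrite !wedge_cons !interior_lin // wedgeDl wedgeZl.
    rewrite wedgeDr wedgeZr.
    by rewrite !(formDE, formZE) mulrDr addrACA.
  have [fwa fwb] := (forms_interior w fa, forms_interior w fb).
  have fga := forms_gsign fa.
  by rewrite !wedge_cons (IHs1 _ _ fwa fb) (IHs1 _ _ fga fwb) mulrDr addrACA.
split=> //; apply: adjacent_alternating => // s1 s2 v.
elim: s1 a b fa fb {mab} => [|w s1 IHs1] a b fa fb /=.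
  rewrite -[LHS]/(interior v (interior v (wedge a b)) s2) !interior_wedge interiorD.
  rewrite !interior_wedge !interior_interior ?interior_gsign ?gsignK //.
  by rewrite wedge0r wedge0l wedgeNl addr0 add0r subrr.
rewrite wedge_cons !IHs1 ?addr0 //; do ?exact: forms_interior.
exact: forms_gsign.
Qed.

Lemma forms_one : forms (@form_one R V).
Proof.
split=> [s1 s2 k u v|s1 s2 s3 v]; rewrite /form_one; case: s1 => [|w s1] //=;
by rewrite ?mulr0 ?addr0.
Qed.

(** A list longer than the dimension is linearly dependent, and an alternating
    multilinear function vanishes on dependent lists: expand a vector that lies
    in the span of the later ones. *)
Lemma forms_dependent rho s : forms rho -> ~~ free s -> rho s = 0.
Proof.
elim: s rho => [|v s IHs] rho frho; first by rewrite nil_free.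
rewrite free_cons negb_and negbK => /orP[vs|nfs]; last first.
  exact: IHs (forms_interior v frho) nfs.
have /= -> := coord_span (vs : v \in <<in_tuple s>>%VS).
rewrite -[LHS]/(interior _ rho s) (interior_sumv _ _ _ frho.1) form_sumE.
rewrite big1 // => i _.
rewrite formZE /interior; set w := nth _ _ _; suff -> : rho (w :: s) = 0.
  by rewrite mulr0.
have : w \in s by apply: mem_nth.
by case/splitPr => s1 s2; apply: (frho.2 [::]).
Qed.

Lemma forms_large rho s : forms rho -> (\dim {:V} < size s)%N -> rho s = 0.
Proof.
move=> frho large; apply: forms_dependent => //; apply/negP => /eqP fs.
by move: large; rewrite -fs ltnNge dimvS ?subvf.
Qed.

Lemma forms_deg_wedge (p q : nat) a b :
  forms_deg p a -> forms_deg q b -> forms_deg (p + q) (wedge a b).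
Proof.
move=> [fa da] [fb db]; split=> [|s sizes]; first exact: forms_wedge.
apply: wedge_eq0 => s1 s2 size12.
have [s1p|s1p] := eqVneq (size s1) p; last by rewrite da ?mul0r.
rewrite [b _]db ?mulr0 //; apply: contra sizes => /eqP <-.
by rewrite -size12 s1p.
Qed.

Lemma forms_deg_lin k z a b :
  forms_deg k a -> forms_deg k b -> forms_deg k (z *: a + b).
Proof.
move=> [fa da] [fb db]; split=> [|s sk]; first exact: forms_lin.
by rewrite formDE formZE da ?db // mulr0 addr0.
Qed.

Lemma forms_deg_sum k (I : Type) (r : seq I) (z : I -> R[i]) (F : I -> form V) :
  (forall i, forms_deg k (F i)) -> forms_deg k (\sum_(i <- r) z i *: F i).
Proof.
move=> fF; elim/big_rec: _ => [|i a _ fa]; last exact: forms_deg_lin.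
by split=> //; apply: forms0.
Qed.

Lemma forms_deg_one : forms_deg 0 (@form_one R V).
Proof. by split; [exact: forms_one|case]. Qed.

Lemma forms_deg0 a : forms_deg 0 a -> a = a [::] *: @form_one R V.
Proof.
case=> _ da; apply/funext => -[|v s]; rewrite formZE /form_one ?eqxx ?mulr1 //.
by rewrite da // mulr0.
Qed.

Lemma forms_deg_interior k v a : forms_deg k.+1 a -> forms_deg k (interior v a).
Proof. by case=> fa da; split=> [|s sk]; [apply: forms_interior|apply: da]. Qed.

Lemma gsign_deg k a : forms_deg k a -> gsign a = (-1) ^+ k *: a.
Proof.
case=> _ da; apply/funext => s; rewrite formZE /gsign.
by have [->//|sk] := eqVneq (size s) k; rewrite da // !mulr0.
Qed.

(** The derivation rule of [interior_wedge] for a 1-form, whose contraction is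
    a scalar. *)
Lemma interior_wedge1 v a rho : forms_deg 1 a ->
  interior v (wedge a rho) = a [:: v] *: rho - wedge a (interior v rho).
Proof.
move=> fa; rewrite interior_wedge (gsign_deg fa) expr1 scaleN1r wedgeNl.
by rewrite (forms_deg0 (forms_deg_interior v fa)) wedgeZl wedge1l.
Qed.

End ExteriorForms.

(** * Truncated exponentials of operators *)

Section TruncatedExponential.
Variables (R : realType) (V : vectType R).
Implicit Types (rho : form V) (z w : R[i]) (A T S : form V -> form V).

Lemma iter_linear A j : linear A -> linear (iter j A).
Proof.
by move=> linA; elim: j => [|j IHj] // z a b; rewrite !iterS IHj linA.
Qed.

Lemma scale_op_linear z A : linear A -> linear (fun rho => z *: A rho).
Proof. by move=> linA w a b; rewrite linA scalerDr !scalerA mulrC. Qed.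

Lemma linear_fun_sum A (I : Type) (r : seq I) (z : I -> R[i]) (F : I -> form V) :
  linear A -> A (\sum_(i <- r) z i *: F i) = \sum_(i <- r) z i *: A (F i).
Proof.
move=> linA; elim: r => [|i r IHr]; last by rewrite !big_cons linA IHr.
rewrite !big_nil; have /eqP := linA 1 0 0.
by rewrite !scale1r addr0 eq_sym -subr_eq0 addrK => /eqP.
Qed.

Lemma exp_op_linear A : linear A -> linear (exp_op A).
Proof.
move=> linA z a b; rewrite /exp_op scaler_sumr -big_split /=.
apply: eq_bigr => j _; rewrite iter_linear // scalerDr !scalerA.
by rewrite [_ * z]mulrC.
Qed.

Lemma iter_scale z A j rho : linear A ->
  iter j (fun r => z *: A r) rho = z ^+ j *: iter j A rho.
Proof.
move=> linA; have scA w r : A (w *: r) = w *: A r.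
  by have := linear_fun_sum [:: tt] (fun=> w) (fun=> r) linA; rewrite !big_seq1.
elim: j => [|j IHj]; first by rewrite expr0 scale1r.
by rewrite !iterS IHj scA scalerA exprS.
Qed.

Lemma exp_op_forms A rho : (forall r, forms r -> forms (A r)) -> forms rho ->
  forms (exp_op A rho).
Proof.
move=> fA frho; apply: forms_sum => j; apply: formsZ.
by elim: (nat_of_ord j) => //= i; apply: fA.
Qed.

(** If S = [A, T] commutes with A, then [A^j, T] = j S A^(j-1), so conjugation
    by the exponential of A turns T into T + S. The last hypothesis makes the
    identity exact for the truncated series. *)
Lemma exp_op_conj A T S rho : linear A -> linear T -> linear S ->
  (forall r, forms r -> forms (A r)) ->
  (forall r, forms r -> A (T r) = T (A r) + S r) ->
  (forall r, forms r -> A (S r) = S (A r)) ->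
  forms rho -> S (iter (\dim {:V}) A rho) = 0 ->
  exp_op A (T rho) = T (exp_op A rho) + S (exp_op A rho).
Proof.
move=> linA linT linS fA AT AS frho top0.
have fiter j : forms (iter j A rho) by elim: j => //= j; apply: fA.
have iterT j : iter j A (T rho) =
    T (iter j A rho) + j%:R *: S (iter j.-1 A rho).
  elim: j => [|j IHj]; first by rewrite scale0r addr0.
  rewrite iterS IHj addrC linA AT // -iterS AS // -addn1 natrD scalerDl scale1r.
  case: j {IHj} => [|j] /=; first by rewrite !scale0r !add0r addrC.
  by rewrite addn1 addrCA.
rewrite /exp_op (linear_fun_sum _ _ _ linT) (linear_fun_sum _ _ _ linS).
under eq_bigr do rewrite iterT scalerDr.
rewrite big_split /=; congr (_ + _).
rewrite big_ord_recl scale0r scaler0 add0r big_ord_recr /= top0 scaler0 addr0.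
apply: eq_bigr => j _; rewrite /bump add1n scalerA factS natrM invfM mulrAC.
by rewrite mulVf ?mul1r // pnatr_eq0.
Qed.

Lemma sum_triangle (M : nmodType) (F : nat -> nat -> M) n :
  (forall j k, (n <= j + k)%N -> F j k = 0) ->
  \sum_(j < n) \sum_(k < n) F j k = \sum_(m < n) \sum_(j < m.+1) F j (m - j)%N.
Proof.
move=> F0; transitivity
  (\sum_(0 <= j < n) \sum_(0 <= m < n | (j <= m)%N) F j (m - j)%N).
  rewrite big_mkord; apply: eq_bigr => j _.
  rewrite -(big_mkord xpredT (F j)) (big_cat_nat _ (leq_subr j n)) //=.
  have -> : \sum_(n - j <= k < n) F j k = 0.
    rewrite big_nat; apply: big1 => k /andP[lek _].
    by rewrite F0 // -leq_subLR.
  rewrite addr0 (big_cat_nat (leq0n j) (ltnW (ltn_ord j))) /=.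
  rewrite [X in _ = X + _]big_nat_cond [X in _ = X + _]big1 => [|k]; last first.
    by case/andP=> /andP[_ kj]; rewrite leqNgt kj.
  transitivity (\sum_(0 + j <= m < n | (j <= m)%N) F j (m - j)%N); last first.
    by rewrite add0r add0n.
  by rewrite big_addn; apply: eq_big => k; rewrite ?leq_addl ?addnK.
rewrite (exchange_big_dep_nat xpredT) //= big_mkord.
apply: eq_bigr => m _.
rewrite -(big_mkord xpredT (fun j => F j (m - j)%N)).
by rewrite (big_nat_widen _ _ _ _ _ (ltn_ord m)).
Qed.

(** The exponentials multiply as power series do. Truncation discards only the
    terms of total degree larger than the dimension of V, and these vanish by
    nilpotency. *)
Lemma exp_op_add A z w rho : linear A -> iter (\dim {:V}).+1 A rho = 0 ->
  exp_op (fun r => z *: A r) (exp_op (fun r => w *: A r) rho) =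
  exp_op (fun r => (z + w) *: A r) rho.
Proof.
move=> linA nilA; have iter0 j : iter j A 0 = 0.
  by have := linear_fun_sum [::] (fun=> 0) id (iter_linear j linA); rewrite !big_nil.
have large m : (\dim {:V} < m)%N -> iter m A rho = 0.
  by move=> /subnK <-; rewrite iterD nilA iter0.
pose F j k := ((j`!%:R)^-1 * z ^+ j * ((k`!%:R)^-1 * w ^+ k)) *: iter (j + k) A rho.
transitivity (\sum_(j < (\dim {:V}).+1) \sum_(k < (\dim {:V}).+1) F j k).
  apply: eq_bigr => j _; rewrite iter_scale // {1}/exp_op.
  under eq_bigr do rewrite iter_scale // scalerA.
  rewrite (linear_fun_sum _ _ _ (iter_linear j linA)).
  rewrite !scaler_sumr; apply: eq_bigr => k _.
  by rewrite !scalerA /F iterD !mulrA.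
rewrite sum_triangle => [|j k jk]; last by rewrite /F large ?scaler0.
apply: eq_bigr => m _; rewrite iter_scale // scalerA addrC exprDn mulr_sumr.
rewrite scaler_suml; apply: eq_bigr => j _; rewrite /F subnKC //; last first.
  by rewrite -ltnS.
congr (_ *: _); have jm : (j <= m)%N by rewrite -ltnS.
have -> : (m`!%:R)^-1 = 'C(m, j)%:R^-1 * (j`!%:R^-1 * (m - j)`!%:R^-1) :> R[i].
  by rewrite -(bin_fact jm) !natrM !invfM.
rewrite -[_ * _ *+ _]mulr_natl [RHS]mulrACA mulVf ?mul1r; last first.
  by rewrite pnatr_eq0 -lt0n bin_gt0.
by rewrite mulrACA [w ^+ _ * _]mulrC.
Qed.

Lemma exp_op0 A rho : exp_op (fun r => 0 *: A r) rho = rho.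
Proof.
rewrite /exp_op big_ord_recl /= fact0 invr1 scale1r big1 ?addr0 // => j _.
by rewrite scale0r scaler0.
Qed.

Lemma exp_opK A z rho : linear A -> iter (\dim {:V}).+1 A rho = 0 ->
  exp_op (fun r => - z *: A r) (exp_op (fun r => z *: A r) rho) = rho.
Proof. by move=> linA nilA; rewrite exp_op_add // addNr exp_op0. Qed.

End TruncatedExponential.

(** * The symplectic form and its dual bivector *)

Section SymplecticForm.
Variables (R : realType) (V : vectType R) (omega : {skew_symmetric V}).
Implicit Types (rho : form V) (u v : V) (X : cvect V).

Local Notation N := (\dim {:V}).
Local Notation b i := ((vbasis {:V})`_i).
Local Notation xi X := (contract X (form_of omega)).

Lemma skewC u v : omega u v = - omega v u.
Proof. by rewrite hermC expr1 mulN1r. Qed.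

Lemma forms_deg_omega : forms_deg 2 (form_of omega).
Proof.
split=> [|[|u [|v [|w s]]]] //; split=> [s1 s2 k u v|s1 s2 s3 v].
  case: s1 => [|w [|w1 [|w2 s1]]]; case: s2 => [|w' [|w1' s2]];
  rewrite /= ?mulr0 ?addr0 //.
    by rewrite linearDl linearZl_LR rmorphD rmorphM.
  by rewrite linearDr linearZr_LR rmorphD rmorphM.
have vv0 : omega v v = 0.
  have : omega v v *+ 2 = 0 by rewrite mulr2n [X in X + _]skewC addNr.
  by move/eqP; rewrite mulrn_eq0 /= => /eqP.
case: s1 => [|w [|w1 s1]]; case: s2 => [|w2 s2]; case: s3 => [|w3 s3] //=;
by [rewrite vv0|case: s2|case: s1].
Qed.

Lemma forms_omega : forms (form_of omega).
Proof. by case: forms_deg_omega. Qed.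

Lemma gsign_omega : gsign (form_of omega) = form_of omega.
Proof. by rewrite (gsign_deg forms_deg_omega) expr2 mulrNN mulr1 scale1r. Qed.

Lemma forms_deg_xi X : forms_deg 1 (xi X).
Proof.
rewrite contractE addrC; apply: forms_deg_lin;
by apply: forms_deg_interior; apply: forms_deg_omega.
Qed.

Lemma xiE X v :
  xi X [:: v] = (omega X.1 v)%:C%C + 'i * (omega X.2 v)%:C%C.
Proof. by []. Qed.

Lemma contract_wedge_omega X rho :
  contract X (wedge (form_of omega) rho) =
  wedge (xi X) rho + wedge (form_of omega) (contract X rho).
Proof.
rewrite !contractE !interior_wedge gsign_omega wedgeDl wedgeZl.
by rewrite wedgeDr wedgeZr scalerDr addrACA.
Qed.

Lemma wedge_omega_xi X rho :
  wedge (form_of omega) (wedge (xi X) rho) =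
  wedge (xi X) (wedge (form_of omega) rho).
Proof. by rewrite !wedgeA (wedge_evenC _ gsign_omega). Qed.

Fact Lambda_is_linear : linear (Lambda omega).
Proof.
move=> z a c; rewrite /Lambda scalerA mulrC -scalerA -scalerDr; congr (_ *: _).
rewrite scaler_sumr -big_split; apply: eq_bigr => i _ /=.
rewrite scaler_sumr -big_split; apply: eq_bigr => j _ /=.
rewrite (contract_is_linear _ z a c) (contract_is_linear _ z (contract _ a)).
by rewrite scalerDr !scalerA mulrC.
Qed.

Lemma forms_Lambda rho : forms rho -> forms (Lambda omega rho).
Proof.
move=> frho; apply/formsZ/forms_sum => i; apply: forms_sum => j; apply: formsZ.
by do 2!apply: forms_contract.
Qed.

Lemma Lambda_eq0 rho s :
  (forall t, size t = (size s).+2 -> rho t = 0) -> Lambda omega rho s = 0.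
Proof.
move=> rho0; rewrite /Lambda formZE form_sumE big1 ?mulr0 // => i _.
rewrite form_sumE big1 // => j _.
by rewrite formZE /contract !rho0 // !(mulr0, addr0).
Qed.

(** This and [iter_Lambda_large] give nilpotency on forms, and kill the top
    terms left over by the truncation of the exponentials: the powers of
    omega /\ raise the degree, and those of [Lambda] lower it, beyond the range
    of degrees of nonzero forms. *)
Lemma iter_wedge_omega_small j rho s : (size s < 2 * j)%N ->
  iter j (wedge (form_of omega)) rho s = 0.
Proof.
elim: j s => [|j IHj] s; first by rewrite muln0.
move=> smalls; rewrite iterS; apply: wedge_eq0 => s1 s2 size12.
have [s12|s12] := eqVneq (size s1) 2; last by rewrite forms_deg_omega.2 ?mul0r.
rewrite IHj ?mulr0 //; move: smalls.
by rewrite -size12 s12 mulnS ltn_add2l.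
Qed.

Lemma iter_Lambda_large j rho s : forms rho -> (N < size s + 2 * j)%N ->
  iter j (Lambda omega) rho s = 0.
Proof.
move=> frho; elim: j s => [|j IHj] s larges.
  by apply: forms_large; rewrite // -[size s]addn0.
apply: Lambda_eq0 => t sizet; apply: IHj; rewrite sizet.
by rewrite mulnS addnA addn2 in larges.
Qed.

Lemma iter_forms (A : form V -> form V) j rho :
  (forall r, forms r -> forms (A r)) -> forms rho -> forms (iter j A rho).
Proof. by move=> fA frho; elim: j => //= j; apply: fA. Qed.

Lemma wedge_omega_nilpotent rho : forms rho ->
  iter N.+1 (wedge (form_of omega)) rho = 0.
Proof.
move=> frho; apply/funext => s; have [large|small] := ltnP N (size s).
  apply: forms_large large; apply: iter_forms => // r.
  exact: forms_wedge forms_omega.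
apply: iter_wedge_omega_small; rewrite (leq_ltn_trans small) // mul2n -addnn.
by rewrite addSn ltnS leq_addr.
Qed.

Lemma Lambda_nilpotent rho : forms rho -> iter N.+1 (Lambda omega) rho = 0.
Proof.
move=> frho; apply/funext => s; apply: iter_Lambda_large => //.
by rewrite mul2n -addnn addnA addnC addSn ltnS leq_addr.
Qed.

Hypothesis nondeg : forall u, (forall v, omega u v = 0) -> u = 0.

(** The basis of V that is dual to [vbasis] under omega, see [omega_dual]. *)
Definition dual_vbasis (i : 'I_N) : V :=
  \sum_(k < N) invmx (gram omega) i k *: b k.

Local Notation e := dual_vbasis.

Lemma vbasis_eq0 u : (forall j : 'I_N, omega u (b j) = 0) -> u = 0.
Proof.
move=> u0; apply: nondeg => v; rewrite (coord_vbasis (memvf v)) linear_sumr.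
by rewrite big1 // => j _; rewrite linearZr_LR /= u0 mulr0.
Qed.

Lemma gram_unit : gram omega \in unitmx.
Proof.
rewrite -row_free_unit; apply: inj_row_free => x xW0.
have /freeP free_b : free (vbasis {:V}) by apply: basis_free (vbasisP _).
suff /free_b x0 : \sum_(i < N) x 0 i *: b i = 0.
  by apply/rowP => i; rewrite x0 mxE.
apply: vbasis_eq0 => j; have /rowP/(_ j) := xW0.
rewrite !mxE => <-; rewrite linear_sumlz; apply: eq_bigr => i _.
by rewrite linearZl_LR mxE.
Qed.

Lemma omega_dual (i j : 'I_N) : omega (e i) (b j) = (i == j)%:R.
Proof.
have /matrixP/(_ i j) := mulVmx gram_unit; rewrite !mxE => <-.
rewrite /e linear_sumlz; apply: eq_bigr => k _.
by rewrite linearZl_LR mxE.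
Qed.

Lemma dual_coord v : v = \sum_(i < N) omega (e i) v *: b i.
Proof.
rewrite {1}(coord_vbasis (memvf v)); apply: eq_bigr => i _; congr (_ *: _).
rewrite [in RHS](coord_vbasis (memvf v)) linear_sumr (bigD1 i) //= big1.
  by rewrite linearZr_LR /= omega_dual eqxx mulr1 addr0.
by move=> j ji; rewrite linearZr_LR /= omega_dual eq_sym (negPf ji) mulr0.
Qed.

Lemma dual_expand v : v = \sum_(i < N) omega v (b i) *: e i.
Proof.
apply/eqP; rewrite -subr_eq0; apply/eqP/vbasis_eq0 => j.
rewrite linearBl linear_sumlz (bigD1 j) //= big1 ?addr0 => [|i ij].
  by rewrite linearZl_LR /= omega_dual eqxx mulr1 subrr.
by rewrite linearZl_LR /= omega_dual (negPf ij) mulr0.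
Qed.

(** The coefficients of the bivector are those of the e_i in the basis b, so one
    of the two sums collapses. In this shape commutators with [Lambda] reduce to
    the expansions of a vector in the two dual bases. *)
Lemma Lambda_dual rho : forms rho ->
  Lambda omega rho = 2^-1 *: \sum_(i < N) interior (e i) (interior (b i) rho).
Proof.
move=> frho; congr (_ *: _); rewrite exchange_big; apply: eq_bigr => j _.
have fj := forms_interior (b j) frho.
rewrite (interior_sumv _ _ _ fj.1); apply: eq_bigr => i _; rewrite mxE.
congr (_ *: _); have real v a : multilinear a -> contract (v, 0) a = interior v a.
  by move=> ma; rewrite contractE interior0 // scaler0 addr0.
by rewrite (real _ _ frho.1) (real _ _ fj.1).
Qed.

Lemma xi_expand X rho : forms rho ->
  \sum_(i < N) xi X [:: b i] *: interior (e i) rho = contract X rho.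
Proof.
move=> [mrho _]; rewrite [contract X rho]contractE.
rewrite [in RHS](dual_expand X.1) [in RHS](dual_expand X.2).
rewrite !interior_sumv // scaler_sumr -big_split; apply: eq_bigr => i _ /=.
by rewrite xiE scalerDl scalerA.
Qed.

Lemma xi_expand_dual X rho : forms rho ->
  \sum_(i < N) xi X [:: e i] *: interior (b i) rho = - contract X rho.
Proof.
move=> [mrho _]; rewrite [contract X rho]contractE.
rewrite [in RHS](dual_coord X.1) [in RHS](dual_coord X.2).
rewrite !interior_sumv // scaler_sumr -big_split -sumrN; apply: eq_bigr => i _ /=.
rewrite xiE [omega X.1 _]skewC [omega X.2 _]skewC !rmorphN mulrN -opprD.
by rewrite scaleNr scalerDl scalerA.
Qed.

(** The commutator of iota_(e_i) iota_(b_i) with xi /\ is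
    xi(b_i) iota_(e_i) - xi(e_i) iota_(b_i). For xi = iota_X omega each of the two
    terms sums to iota_X, which the factor 1/2 of [Lambda] makes up for. *)
Lemma Lambda_wedge_xi X rho : forms rho ->
  Lambda omega (wedge (xi X) rho) =
  wedge (xi X) (Lambda omega rho) + contract X rho.
Proof.
move=> frho; have fxi := forms_deg_xi X.
rewrite !Lambda_dual //; last exact: forms_wedge fxi.1 frho.
rewrite wedgeZr (linear_sum (wedge _)) /=.
under eq_bigr => i _ do
  rewrite (interior_wedge1 _ _ fxi) interiorD interiorN interiorZ
    (interior_wedge1 _ _ fxi) opprB addrCA.
rewrite big_split sumrB xi_expand // xi_expand_dual // opprK /= scalerDr.
congr (_ + _); have half : 2^-1 + 2^-1 = 1 :> R[i] by rewrite [RHS]splitr !mul1r.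
by rewrite scalerDr -scalerDl half scale1r.
Qed.

Lemma Lambda_contract X rho : forms rho ->
  Lambda omega (contract X rho) = contract X (Lambda omega rho).
Proof.
move=> frho; rewrite !Lambda_dual //; last exact: forms_contract.
rewrite contractZ (linear_sum (contract _)) /=; congr (_ *: _).
apply: eq_bigr => i _; rewrite interior_contract // interiorN.
by rewrite interior_contract ?opprK //; apply: forms_interior.
Qed.

(** The Euler identity. Contracting the sum with v gives iota_v rho, because the
    1-forms omega(e_i, _) are the coordinates in the basis b, plus the same sum
    for iota_v rho; so the value on a list counts its entries. *)
Lemma sum_wedge_interior rho s : forms rho ->
  (\sum_(i < N) wedge (xi (e i, 0)) (interior (b i) rho)) s = (size s)%:R * rho s.
Proof.
elim: s rho => [|v s IHs] rho frho; rewrite form_sumE.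
  rewrite mul0r big1 // => i _; rewrite wedge_nil.
  by rewrite (forms_deg_xi _).2 ?mul0r.
transitivity (interior v (\sum_(i < N) wedge (xi (e i, 0)) (interior (b i) rho)) s).
  by rewrite /interior form_sumE.
have -> : interior v (\sum_(i < N) wedge (xi (e i, 0)) (interior (b i) rho)) =
    interior v rho +
    \sum_(i < N) wedge (xi (e i, 0)) (interior (b i) (interior v rho)).
  have vE : interior v rho = \sum_(i < N) (omega (e i) v)%:C%C *: interior (b i) rho.
    by rewrite {1}(dual_coord v) (interior_sumv _ _ _ frho.1).
  rewrite linear_sum /= [X in _ = X + _]vE -big_split; apply: eq_bigr => i _ /=.
  rewrite (interior_wedge1 _ _ (forms_deg_xi _)).
  rewrite [interior v (interior (b i) rho)]interiorC // wedgeNr opprK.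
  congr (_ *: _ + _).
  by rewrite xiE /= linear0l rmorph0 mulr0 addr0.
rewrite formDE IHs; last exact: forms_interior.
by rewrite /= -natr1 mulrDl mul1r addrC.
Qed.

End SymplecticForm.

(** * The Clifford action and the spaces U *)

Section CliffordIntertwining.
Variables (R : realType) (V : vectType R) (omega : {skew_symmetric V}).
Implicit Types (alpha rho : form V) (X : cvect V).

Local Notation N := (\dim {:V}).
Local Notation xi X := (contract X (form_of omega)).
Local Notation W := (wedge (form_of omega)).
Local Notation iW := (fun r => 'i *: W r).
Local Notation cLambda := (fun r => (2 * 'i)^-1 *: Lambda omega r).

Lemma wedge_iomegaE : wedge ('i *: form_of omega) = iW.
Proof. by apply/funext => r; rewrite wedgeZl. Qed.

Lemma wedge_exp_iomega rho : wedge (exp_iomega omega) rho = exp_op iW rho.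
Proof.
rewrite /exp_iomega wedge_iomegaE /exp_op wedge_suml; apply: eq_bigr => j _.
rewrite wedgeZl; congr (_ *: _); elim: (nat_of_ord j) => [|k IHk] /=.
  exact: wedge1l.
by rewrite wedgeZl -wedgeA IHk.
Qed.

Lemma phiE alpha : phi omega alpha = exp_op iW (exp_op cLambda alpha).
Proof. exact: wedge_exp_iomega. Qed.

Let linW : linear W := @wedge_is_linear R V (form_of omega).
Let linL : linear (Lambda omega) := @Lambda_is_linear R V omega.

Lemma phi_linear : linear (phi omega).
Proof.
move=> z a b; rewrite !phiE -exp_op_linear; last exact: scale_op_linear.
by rewrite -exp_op_linear //; apply: scale_op_linear.
Qed.

Lemma phi_lin_sum (I : Type) (r : seq I) (z : I -> R[i]) (F : I -> form V) :
  phi omega (\sum_(i <- r) z i *: F i) = \sum_(i <- r) z i *: phi omega (F i).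
Proof. exact: linear_fun_sum phi_linear. Qed.

Lemma forms_scale_wedge_omega z rho : forms rho -> forms (z *: W rho).
Proof. by move=> frho; apply/formsZ/forms_wedge => //; apply: forms_omega. Qed.

Lemma forms_scale_Lambda z rho : forms rho -> forms (z *: Lambda omega rho).
Proof. by move=> frho; apply/formsZ/forms_Lambda. Qed.

Lemma forms_phi alpha : forms alpha -> forms (phi omega alpha).
Proof.
move=> fa; rewrite phiE; apply: exp_op_forms => [r|].
  exact: forms_scale_wedge_omega.
by apply: exp_op_forms => // r; apply: forms_scale_Lambda.
Qed.

(** The inverse composes, in the opposite order, the exponentials of the opposite
    operators. *)
Lemma phi_bij : set_bij forms forms (phi omega).
Proof.
have fL z rho : forms rho -> forms (exp_op (fun r => z *: Lambda omega r) rho).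
  by move=> frho; apply: exp_op_forms => // r; apply: forms_scale_Lambda.
have fW z rho : forms rho -> forms (exp_op (fun r => z *: W r) rho).
  by move=> frho; apply: exp_op_forms => // r; apply: forms_scale_wedge_omega.
have LK z rho : forms rho -> exp_op (fun r => - z *: Lambda omega r)
    (exp_op (fun r => z *: Lambda omega r) rho) = rho.
  by move=> frho; apply: exp_opK => //; apply: Lambda_nilpotent.
have WK z rho : forms rho -> exp_op (fun r => - z *: W r)
    (exp_op (fun r => z *: W r) rho) = rho.
  by move=> frho; apply: exp_opK => //; apply: wedge_omega_nilpotent.
split=> [alpha|alpha beta|rho frho]; first exact: forms_phi.
  move=> /set_mem fa /set_mem fb; rewrite !phiE.
  move=> /(congr1 (exp_op (fun r => - 'i *: W r))); rewrite !WK; try exact: fL.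
  move=> /(congr1 (exp_op (fun r => - (2 * 'i)^-1 *: Lambda omega r))).
  by rewrite !LK.
exists (exp_op (fun r => - (2 * 'i)^-1 *: Lambda omega r)
         (exp_op (fun r => - 'i *: W r) rho)); first by apply/fL/fW.
have := LK (- (2 * 'i)^-1) _ (fW (- 'i) _ frho); rewrite opprK phiE => ->.
by have := WK (- 'i) _ frho; rewrite opprK.
Qed.

Lemma phi_one : phi omega (@form_one R V) = exp_iomega omega.
Proof.
have L1 j : iter j.+1 (Lambda omega) (@form_one R V) = 0.
  elim: j => [|j IHj]; first by apply/funext => s; apply: Lambda_eq0 => -[].
  by rewrite iterS IHj; apply/funext => s; apply: Lambda_eq0.
rewrite phiE /exp_iomega wedge_iomegaE; congr exp_op.
rewrite /exp_op big_ord_recl fact0 invr1 scale1r big1 ?addr0 // => j _.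
by rewrite iter_scale // L1 !scaler0.
Qed.

Lemma exp_wedge_omega_xi X rho : forms rho ->
  exp_op iW (wedge (xi X) rho) = wedge (xi X) (exp_op iW rho).
Proof.
move=> frho; rewrite (exp_op_conj (T := wedge (xi X)) (S := fun=> 0)) ?addr0 //.
- exact: scale_op_linear.
- exact: wedge_is_linear.
- by move=> z a b; rewrite scaler0 addr0.
- by move=> r; apply: forms_scale_wedge_omega.
- by move=> r _; rewrite wedge_omega_xi wedgeZr addr0.
- by move=> r _; rewrite wedge0r scaler0.
Qed.

Lemma exp_wedge_omega_contract X rho : forms rho ->
  exp_op iW (contract X rho) =
  contract X (exp_op iW rho) - 'i *: wedge (xi X) (exp_op iW rho).
Proof.
move=> frho; pose S r := - 'i *: wedge (xi X) r.
rewrite (exp_op_conj (T := contract X) (S := S)) ?/S ?scaleNr //.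
- exact: scale_op_linear.
- exact: contract_is_linear.
- by apply: scale_op_linear; apply: wedge_is_linear.
- by move=> r; apply: forms_scale_wedge_omega.
- move=> r _; rewrite contractZ contract_wedge_omega scalerDr scaleNr.
  by rewrite addrAC subrr add0r.
- by move=> r _; rewrite !wedgeZr wedge_omega_xi !scalerA mulrC.
rewrite iter_scale // wedgeZr !scalerA; set t := wedge _ _.
(* The form t lies in degrees above twice the dimension. *)
suff -> : t = 0 by rewrite scaler0 oppr0.
have ft : forms t.
  apply: forms_wedge (forms_deg_xi omega X).1 _; apply: iter_forms => // r.
  exact/forms_wedge/forms_omega.
apply/funext => s; have [large|small] := ltnP N (size s).
  exact: forms_large.
apply: wedge_eq0 => s1 s2 size12.
have [s11|s11] := eqVneq (size s1) 1; last by rewrite (forms_deg_xi _ _).2 ?mul0r.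
rewrite iter_wedge_omega_small ?mulr0 // mul2n -addnn.
by apply: leq_trans (leq_addr N N); rewrite -size12 s11 in small.
Qed.

Hypothesis nondeg : forall u, (forall v, omega u v = 0) -> u = 0.

Lemma exp_Lambda_wedge_xi X alpha : forms alpha ->
  exp_op cLambda (wedge (xi X) alpha) =
  wedge (xi X) (exp_op cLambda alpha) +
  (2 * 'i)^-1 *: contract X (exp_op cLambda alpha).
Proof.
move=> fa; pose S r := (2 * 'i)^-1 *: contract X r.
apply: (exp_op_conj (T := wedge (xi X)) (S := S)) => //.
- exact: scale_op_linear.
- exact: wedge_is_linear.
- by apply: scale_op_linear; apply: contract_is_linear.
- by move=> r; apply: forms_scale_Lambda.
- by move=> r fr; rewrite (Lambda_wedge_xi nondeg) // scalerDr [in RHS]wedgeZr.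
- move=> r fr; rewrite /S contractZ -Lambda_contract //.
  have := linear_fun_sum [:: tt] (fun=> (2 * 'i)^-1) (fun=> contract X r) linL.
  by rewrite !big_seq1 => ->.
rewrite /S iter_scale // contractZ; set t := contract _ _.
suff -> : t = 0 by rewrite !scaler0.
apply/funext => s; rewrite /t /contract !iter_Lambda_large ?mulr0 ?addr0 //;
by rewrite /= mul2n -addnn addSn addnA ltnS leq_addl.
Qed.

(** The core of the proof. The exponential of [Lambda] / 2i turns 2i xi^ into
    2i xi^ + iota_X, and the exponential of i omega turns iota_X into
    iota_X - i xi^; altogether 2i xi^ becomes iota_X + i xi^, the action of an
    element of the conjugate of L. *)
Lemma phi_clifford X alpha : forms alpha ->
  phi omega ((2 * 'i) *: wedge (xi X) alpha) =
  clifford (X, 'i *: xi X) (phi omega alpha).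
Proof.
move=> fa; have := phi_lin_sum [:: tt] (fun=> 2 * 'i) (fun=> wedge (xi X) alpha).
rewrite !big_seq1 => ->; rewrite !phiE exp_Lambda_wedge_xi //.
have fb : forms (exp_op cLambda alpha).
  by apply: exp_op_forms => // r; apply: forms_scale_Lambda.
set beta := exp_op cLambda alpha in fb *.
rewrite [X in exp_op iW X]addrC (exp_op_linear (scale_op_linear 'i linW)).
rewrite exp_wedge_omega_xi // exp_wedge_omega_contract //.
set gamma := exp_op iW beta.
have i2 : 2 * 'i != 0 :> R[i] by rewrite mulf_neq0 ?neq0Ci ?pnatr_eq0.
rewrite scalerDr scalerA mulfV // scale1r /clifford /= wedgeZl -addrA.
congr (_ + _); rewrite -scaleNr -scalerDl; congr (_ *: _).
by rewrite mulr_natl mulr2n addKr.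
Qed.

Lemma cspan_sub_phi k (S : set (form V)) :
  S `<=` phi omega @` forms_deg k -> cspan S `<=` phi omega @` forms_deg k.
Proof.
move=> SU _ [m [c [f [fS ->]]]].
have /choice[alpha alphaP] i : exists a, forms_deg k a /\ phi omega a = f i.
  by have [a ka fa] := SU _ (fS i); exists a.
exists (\sum_(i < m) c i *: alpha i).
  by apply: forms_deg_sum => i; case: (alphaP i).
by rewrite phi_lin_sum; apply: eq_bigr => i _; case: (alphaP i) => _ ->.
Qed.

(** In degree k + 1 the Euler identity writes any form as a combination of
    products xi /\ alpha with alpha of degree k, so [phi_clifford] carries the
    recursive definition of the spaces to the degrees of forms. *)
Lemma Uspace_phi k : Uspace omega k = phi omega @` forms_deg k.
Proof.
elim: k => [|k IHk] /=; apply/seteqP; split.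
- apply: cspan_sub_phi => _ ->; exists (@form_one R V); last exact: phi_one.
  exact: forms_deg_one.
- move=> _ [alpha /forms_deg0 -> <-].
  exists 1, (fun=> alpha [::]), (fun=> exp_iomega omega); split=> //.
  rewrite big_ord1 -phi_one.
  by have := phi_lin_sum [:: tt] (fun=> alpha [::]) (fun=> @form_one R V);
     rewrite !big_seq1.
- apply: cspan_sub_phi => _ [_ [X _ <-]] [_ /[!IHk] -[alpha ka <-] <-].
  exists ((2 * 'i) *: wedge (xi X) alpha); last by rewrite phi_clifford //; case: ka.
  rewrite -[_ *: _]addr0; apply: forms_deg_lin.
    exact: (forms_deg_wedge (forms_deg_xi omega X) ka).
  by split=> //; apply: forms0.
move=> _ [alpha [fa da] <-].
pose e i : cvect V := (dual_vbasis omega i, 0).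
pose b i := interior (vbasis {:V})`_i alpha.
have kb i : forms_deg k (b i) by apply: forms_deg_interior.
have i2 : 2 * 'i != 0 :> R[i] by rewrite mulf_neq0 ?neq0Ci ?pnatr_eq0.
exists N, (fun=> (k.+1%:R)^-1 * (2 * 'i)^-1).
exists (fun i => clifford (e i, 'i *: xi (e i)) (phi omega (b i))); split.
  move=> i; exists (e i, 'i *: xi (e i)); first by exists (e i).
  by exists (phi omega (b i)) => //; rewrite IHk; exists (b i).
transitivity (\sum_(i < N) ((k.+1%:R)^-1 * (2 * 'i)^-1) *:
    phi omega ((2 * 'i) *: wedge (xi (e i)) (b i))); last first.
  by apply: eq_bigr => i _; rewrite phi_clifford //; case: (kb i).
rewrite -phi_lin_sum; congr phi; apply/funext => s.
rewrite form_sumE.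
under eq_bigr => i _ do rewrite formZE formZE -mulrA mulKf //.
have := sum_wedge_interior nondeg s fa; rewrite form_sumE => euler.
rewrite -mulr_sumr euler.
have [->|sk] := eqVneq (size s) k.+1; last by rewrite da // !mulr0.
by rewrite mulrA mulVf ?mul1r // pnatr_eq0.
Qed.

End CliffordIntertwining.

Theorem theorem5p1 (R : realType) (V : vectType R) (n : nat)
    (omega : {skew_symmetric V})
    (dimV : \dim {:V} = (2 * n)%N) (symplectic_omega : is_psymplectic omega) :
  (forall k : nat, (k <= 2 * n)%N ->
     Uspace omega k =
       [set wedge (exp_iomega omega) (exp_Lambda_2i omega alpha)
         | alpha in forms_deg k]) /\
  [/\ linear (phi omega),
      set_bij forms forms (phi omega) &
      forall k : nat, (k <= 2 * n)%N ->
        set_bij (forms_deg k) (Uspace omega k) (phi omega)].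
Proof.
have nondeg u : (forall v, omega u v = 0) -> u = 0.
  move=> u0; case: symplectic_omega => /eqP rad0 _ _.
  by apply/eqP; rewrite -memv0 -rad0; apply/mem_orthovP => v _.
have UE k := Uspace_phi nondeg k.
have [_ phi_inj _] := phi_bij omega.
split=> [k _|]; first exact: UE.
split=> [|| k _]; [exact: phi_linear|exact: phi_bij|rewrite UE; split=> //].
move=> a b /set_mem[fa _] /set_mem[fb _].
by apply: phi_inj; apply: mem_set.
Qed.
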